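(* Let $s\in\mathbb R^C$, let $P_s(j)=e^{s_j}/\sum_{l=1}^C e^{s_l}$ be the softmax distribution, let $Q$ be a probability distribution on $\{1,\dots,C\}$ with $Q(j)>0$ for all $j$, and let $k\ge1$. Let $y'_1,\dots,y'_k$ be i.i.d. from $Q$, and let the (corrected) sampled softmax estimate of the log-partition function be $\log X_k$ with $$X_k=\frac1k\sum_{i=1}^k\frac{e^{s_{y'_i}}}{Q(y'_i)}.$$ Then its delta-method asymptotic bias, curvature bias and variance relative to $\log\sum_j e^{s_j}$ are $$\mathrm{Bias}^{\mathrm{asym}}_{\mathrm{SSM}}=0,\qquad \mathrm{Bias}^{\mathrm{curv}}_{\mathrm{SSM}}=-\frac1{2k}\,\chi^2(P_s\|Q),\qquad \mathrm{Var}_{\mathrm{SSM}}=\frac1k\,\chi^2(P_s\|Q).$$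
   Context: For an estimator of the form $g(X_k)$ of $\log\sum_{j=1}^C e^{s_j}$, where $X_k$ is an average of $k$ i.i.d. random variables with $\mu_X=\mathbb E[X_k]$, $\sigma_X^2=\operatorname{Var}(X_k)$ and $g$ is twice differentiable at $\mu_X$, the (second-order) delta-method quantities are defined as: asymptotic bias $g(\mu_X)-\log\sum_j e^{s_j}$; curvature bias $\tfrac12 g''(\mu_X)\sigma_X^2$; variance $[g'(\mu_X)]^2\sigma_X^2$. Here $g=\log$. $\chi^2(P\|Q)=\sum_j\frac{(P(j)-Q(j))^2}{Q(j)}$. *)

(* Defs.v *)
From HB Require Import structures.
From mathcomp Require Import all_boot all_order all_algebra.
From mathcomp Require Import all_classical all_reals all_analysis.

Set Implicit Arguments.
Unset Strict Implicit.
Unset Printing Implicit Defensive.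

Import Order.TTheory GRing.Theory Num.Theory.
Import numFieldNormedType.Exports.

Local Open Scope ring_scope.
Local Open Scope classical_set_scope.

Section FiniteDistributions.
Context {R : realType} {C : nat}.
Implicit Types (s P Q : 'I_C -> R).

Definition is_distribution Q : Prop :=
  (forall j, 0 <= Q j) /\ \sum_(j < C) Q j = 1.

Definition softmax s : 'I_C -> R :=
  fun j => expR (s j) / \sum_(l < C) expR (s l).

Definition log_partition s : R := ln (\sum_(j < C) expR (s j)).

Definition chi2 P Q : R := \sum_(j < C) (P j - Q j) ^+ 2 / Q j.

End FiniteDistributions.

(* The label set 'I_C carries its discrete sigma-algebra, so events of the form
   y i \in B are indexed by arbitrary sets B. It is not registered as a
   measurableType because the latter must be pointed, whereas 'I_0 is empty. *)
Section Sampling.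
Context {d : measure_display} {T : measurableType d} {R : realType}.
Context (P : probability T R) {C k : nat}.

Definition mutually_independent (y : 'I_k -> T -> 'I_C) : Prop :=
  forall (J : {set 'I_k}) (B : 'I_k -> set 'I_C),
    P (\bigcap_(i in [set` J]) (y i @^-1` B i)) =
    (\prod_(i in J) P (y i @^-1` B i))%E.

Definition iid_from (Q : 'I_C -> R) (y : 'I_k -> T -> 'I_C) : Prop :=
  [/\ forall i (B : set 'I_C), d.-measurable (y i @^-1` B),
      forall i j, P (y i @^-1` [set j]) = (Q j)%:E
    & mutually_independent y].

End Sampling.

Definition ssm_average {T : Type} {R : realType} {C k : nat}
    (s Q : 'I_C -> R) (y : 'I_k -> T -> 'I_C) : T -> R :=
  fun w => k%:R^-1 * \sum_(i < k) (expR (s (y i w)) / Q (y i w)).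

Section DeltaMethod.
Context {d : measure_display} {T : measurableType d} {R : realType}.
Context (P : probability T R).

Definition rv_mean (X : T -> R) : R := fine ('E_P[X])%E.

Definition rv_variance (X : T -> R) : R := fine (variance P X).

Definition twice_derivable (g : R -> R) (a : R) : Prop :=
  (\forall x \near a, derivable g x 1) /\ derivable (derive1 g) a 1.

(* When this fails, fine and the derivatives below return default values and
   the delta-method quantities have no meaning. *)
Definition delta_method_defined (g : R -> R) (X : T -> R) : Prop :=
  X \in Lfun P 2%:E /\ twice_derivable g (rv_mean X).

Definition delta_bias_asym {C : nat} (g : R -> R) (X : T -> R)
    (s : 'I_C -> R) : R :=
  g (rv_mean X) - log_partition s.

Definition delta_bias_curv (g : R -> R) (X : T -> R) : R :=
  2^-1 * derive1n 2 g (rv_mean X) * rv_variance X.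

Definition delta_variance (g : R -> R) (X : T -> R) : R :=
  (derive1 g (rv_mean X)) ^+ 2 * rv_variance X.

End DeltaMethod.

(* Main.v *)
(* The weights e^(s_j) / Q_j have mean Z = sum_j e^(s_j) under Q, and variance
   sum_j (e^(s_j) / Q_j - Z)^2 Q_j = Z^2 chi2(P_s, Q). Hence X_k has mean Z and,
   its summands being pairwise uncorrelated, variance Z^2 chi2(P_s, Q) / k; the
   factors Z^2 cancel against ln'(Z)^2 = Z^-2 and ln''(Z) = - Z^-2. *)

Require Import Defs.
From mathcomp Require Import all_boot all_order all_algebra.
From mathcomp Require Import all_classical all_reals all_analysis.
From mathcomp Require Import measurable_realfun ring.

Set Implicit Arguments.
Unset Strict Implicit.
Unset Printing Implicit Defensive.

Import Order.TTheory GRing.Theory Num.Theory.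
Import numFieldNormedType.Exports.

Local Open Scope ring_scope.
Local Open Scope classical_set_scope.

(** * Functions of a finite-valued random variable *)

Section FiniteValued.
Context {d : measure_display} {T : measurableType d} {R : realType}.
Context (P : probability T R) {I : finType} (Y : T -> I).
Hypothesis mY : forall j, measurable (Y @^-1` [set j]).
Implicit Types h : I -> R.

(** Each w lies in exactly one fiber of [Y], so only the term j = [Y w] survives. Measurability,
    integrability and expectation thereby reduce to indicators of fibers. *)
Lemma fin_rvE h :
  h \o Y = fun w => \sum_j h j * \1_(Y @^-1` [set j]) w.
Proof.
apply/funext => w /=; rewrite (bigD1 (Y w)) //= indicE mem_set // mulr1.
rewrite big1 ?addr0 // => j jY; rewrite indicE memNset ?mulr0 // => /= Yj.
by rewrite Yj eqxx in jY.
Qed.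

Lemma measurable_fin_rv h : measurable_fun [set: T] (h \o Y).
Proof.
rewrite fin_rvE; apply: measurable_sum => j.
by apply: measurable_funM => //; exact: measurable_indic.
Qed.

Lemma integrable_scale_indic_fiber h j :
  P.-integrable [set: T] (fun w => (h j * \1_(Y @^-1` [set j]) w)%:E).
Proof.
under eq_fun do rewrite EFinM.
by apply: integrableZl => //; exact: integrable_indic.
Qed.

Lemma integrable_fin_rv h : P.-integrable [set: T] (EFin \o (h \o Y)).
Proof.
rewrite fin_rvE (_ : _ \o _ =
    fun w => \sum_(j <- index_enum I) (h j * \1_(Y @^-1` [set j]) w)%:E)%E.
  by apply: integrable_sum => // j _; exact: integrable_scale_indic_fiber.
by apply/funext => w /=; rewrite sumEFin.
Qed.

Lemma expectation_fin_rv h :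
  'E_P[h \o Y]%E = (\sum_j h j * fine (P (Y @^-1` [set j])))%:E.
Proof.
rewrite unlock fin_rvE.
under eq_integral do rewrite -sumEFin.
rewrite integral_sum //; last exact: integrable_scale_indic_fiber.
rewrite -sumEFin; apply: eq_bigr => j _.
under eq_integral do rewrite EFinM.
rewrite integralZl //; last exact: integrable_indic.
by rewrite integral_indic // setIT EFinM fineK // fin_num_measure.
Qed.

(** The square of the absolute value of [h \o Y] is again a function of [Y], hence integrable. *)
Lemma Lfun2_fin_rv h : h \o Y \in Lfun P 2%:E.
Proof.
rewrite inE; apply/andP; split; rewrite inE /=.
  exact: measurable_fin_rv.
rewrite /finite_norm unlock /Lnorm poweR_lty //.
have /integrableP[_] := integrable_fin_rv (fun j => `|h j| `^ 2).
apply: le_lt_trans; apply: ge0_le_integral => //.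
- by move=> w _; exact: poweR_ge0.
- by apply: (measurableT_comp (measurable_poweR _));
    apply: measurableT_comp => //; apply/measurable_EFinP; exact: measurable_fin_rv.
- by apply: measurableT_comp => //; apply/measurable_EFinP; exact: measurable_fin_rv.
- by move=> w _ /=; rewrite lee_fin ler_norm.
Qed.

End FiniteValued.

(** * First and second derivatives of the logarithm *)

Lemma derive1_near_ln (R : realType) (a : R) : 0 < a ->
  {near a, (@ln R)^`() =1 GRing.inv}.
Proof.
move=> a0; near=> x; rewrite derive1E.
have x0 : 0 < x by near: x; exact: lt_nbhsr.
by have /@derive_val := is_derive1_ln x0.
Unshelve. all: by end_near. Qed.

(** Differentiation is local: the derivative of [ln] agrees with the inverse on a whole
    neighbourhood of a, so the inverse can be differentiated in its place. *)
Lemma is_derive_derive1_ln (R : realType) (a : R) : 0 < a ->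
  is_derive a 1 (@ln R)^`() (- a ^- 2).
Proof.
move=> a0; apply: (near_eq_is_derive (f := fun x : R => x^-1)).
  by apply: filterS (derive1_near_ln a0) => x ->.
rewrite -[X in is_derive _ _ _ X](mulr1 (- a ^- 2)).
by apply: (@is_deriveV _ id) => //; rewrite gt_eqF.
Qed.

Lemma twice_derivable_ln (R : realType) (a : R) : 0 < a ->
  twice_derivable (@ln R) a.
Proof.
move=> a0; split; last by have [] := is_derive_derive1_ln a0.
near=> x; have x0 : 0 < x by near: x; exact: lt_nbhsr.
by have [] := is_derive1_ln x0.
Unshelve. all: by end_near. Qed.

(** * Moments of sums over an i.i.d. sample *)

Section IidSample.
Context {d : measure_display} {T : measurableType d} {R : realType}.
Context (P : probability T R) {C k : nat}.
Context (Q : 'I_C -> R) (y : 'I_k -> T -> 'I_C).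
Hypothesis y_iid : iid_from P Q y.
Implicit Types h : 'I_C -> R.

Lemma measurable_sample_fiber i (B : set 'I_C) : measurable (y i @^-1` B).
Proof. by have [+ _ _] := y_iid; apply. Qed.

Lemma fine_sample_law i j : fine (P (y i @^-1` [set j])) = Q j.
Proof. by have [_ -> _] := y_iid. Qed.

Lemma sample_pair_law i i' j j' : i != i' ->
  P (y i @^-1` [set j] `&` y i' @^-1` [set j']) = (Q j * Q j')%:E.
Proof.
move=> ii'; have [_ law] := y_iid.
(* Mutual independence is specialised to a two-element index set; since i and i' differ, the test on
   l assigns [[set j]] to i and [[set j']] to i'. *)
move=> /(_ [set i; i']%SET (fun l => if l == i then [set j] else [set j'])).
have -> : [set` [set i; i']%SET] = [set i; i'] :> set 'I_k.
  apply/seteqP; split=> l /=; rewrite !inE.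
    by case/orP=> /eqP ->; [left|right].
  by case=> ->; rewrite eqxx ?orbT.
rewrite bigcap_setU !bigcap_set1 eqxx eq_sym (negbTE ii') => ->.
rewrite big_setU1 ?inE //= big_set1 eqxx eq_sym (negbTE ii') EFinM.
by rewrite !law.
Qed.

Lemma expectation_sample i h : 'E_P[h \o y i]%E = (\sum_j h j * Q j)%:E.
Proof.
rewrite expectation_fin_rv => [|j]; last exact: measurable_sample_fiber.
by congr EFin; apply: eq_bigr => j _; rewrite fine_sample_law.
Qed.

(** The pair of draws is itself a finite-valued variable, with law the product of [Q] with itself,
    so the double sum factors. *)
Lemma expectation_sample_pair i i' h h' : i != i' ->
  'E_P[(fun w => h (y i w) * h' (y i' w))%R]%E =
  ((\sum_j h j * Q j) * (\sum_j h' j * Q j))%:E.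
Proof.
move=> ii'.
have fiberE (u : 'I_C * 'I_C) : (fun w => (y i w, y i' w)) @^-1` [set u] =
    y i @^-1` [set u.1] `&` y i' @^-1` [set u.2].
  by case: u => a b; apply/seteqP; split=> w /= [-> ->].
rewrite (@expectation_fin_rv _ _ _ P _ (fun w => (y i w, y i' w)) _
  (fun u => h u.1 * h' u.2)) => [|u]; last first.
  by rewrite fiberE; apply: measurableI; exact: measurable_sample_fiber.
rewrite big_distrlr pair_big /=; congr EFin; apply: eq_bigr => u _.
by rewrite fiberE sample_pair_law //= mulrACA.
Qed.

(** The whole sample as one variable: finite functions form a [finType], so the results on
    finite-valued variables apply to any statistic of the sample and turn its moments into finite
    sums. *)
Definition sample_vector (w : T) : {ffun 'I_k -> 'I_C} := [ffun i => y i w].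

Lemma measurable_sample_vector_fiber v :
  measurable (sample_vector @^-1` [set v]).
Proof.
rewrite (_ : _ @^-1` _ = \bigcap_(i in [set: 'I_k]) y i @^-1` [set v i]).
  by apply: fin_bigcap_measurable => // i _; exact: measurable_sample_fiber.
apply/seteqP; split=> w /=; first by move=> <- i _; rewrite /= ffunE.
by move=> yv; apply/ffunP => i; rewrite ffunE; exact: yv.
Qed.

Definition sample_vector_pmf v : R := fine (P (sample_vector @^-1` [set v])).

Lemma expectation_sample_vector (F : {ffun 'I_k -> 'I_C} -> R) :
  'E_P[F \o sample_vector]%E = (\sum_v F v * sample_vector_pmf v)%:E.
Proof. exact: expectation_fin_rv measurable_sample_vector_fiber _. Qed.

(** Both sides are the expectation of [h \o y i], computed once through the sample vector and once
    through the single draw. *)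
Lemma sample_vector_marginal i h :
  \sum_(v : {ffun 'I_k -> 'I_C}) h (v i) * sample_vector_pmf v =
  \sum_j h j * Q j.
Proof.
apply: EFin_inj.
rewrite -(expectation_sample_vector (fun v : {ffun 'I_k -> 'I_C} => h (v i))) -(expectation_sample i).
by congr expectation; apply/funext => w; rewrite /= ffunE.
Qed.

Lemma sample_vector_pair_marginal i i' h h' : i != i' ->
  \sum_(v : {ffun 'I_k -> 'I_C}) h (v i) * h' (v i') * sample_vector_pmf v =
  (\sum_j h j * Q j) * (\sum_j h' j * Q j).
Proof.
move=> ii'; apply: EFin_inj.
rewrite -(expectation_sample_vector (fun v : {ffun 'I_k -> 'I_C} => h (v i) * h' (v i'))).
rewrite -(expectation_sample_pair _ _ ii').
by congr expectation; apply/funext => w; rewrite /= !ffunE.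
Qed.

Lemma sample_vector_sum_mean h :
  \sum_(v : {ffun 'I_k -> 'I_C}) (\sum_i h (v i)) * sample_vector_pmf v =
  k%:R * \sum_j h j * Q j.
Proof.
under eq_bigr do rewrite mulr_suml.
rewrite exchange_big /=; under eq_bigr do rewrite sample_vector_marginal.
by rewrite sumr_const card_ord mulr_natl.
Qed.

(* Centering kills the cross terms, by pairwise independence. *)
Lemma sample_vector_sum_sqr h : \sum_j h j * Q j = 0 ->
  \sum_(v : {ffun 'I_k -> 'I_C}) (\sum_i h (v i)) ^+ 2 * sample_vector_pmf v =
  k%:R * \sum_j h j ^+ 2 * Q j.
Proof.
move=> h0; under eq_bigr do rewrite expr2 big_distrlr mulr_suml /=.
rewrite exchange_big /=.
rewrite (eq_bigr (fun=> \sum_j h j ^+ 2 * Q j)) => [|i _].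
  by rewrite sumr_const card_ord mulr_natl.
under eq_bigr do rewrite mulr_suml.
rewrite exchange_big (bigD1 i) //= [X in _ + X]big1 ?addr0 => [|i' i'i].
  under eq_bigr do rewrite -expr2.
  exact: (sample_vector_marginal i (fun j => h j ^+ 2)).
by rewrite sample_vector_pair_marginal 1?eq_sym // h0 mul0r.
Qed.

End IidSample.

(** * Mean and variance of a single importance weight *)

Lemma importance_weight_mean (R : realType) C (s Q : 'I_C -> R) :
  (forall j, 0 < Q j) ->
  \sum_j expR (s j) / Q j * Q j = \sum_j expR (s j).
Proof. by move=> Q0; apply: eq_bigr => j _; rewrite divfK // gt_eqF. Qed.

(** The distribution [Q] rules out C = 0, where its total mass would be an empty sum; the partition
    sum then has a positive term. *)
Lemma sum_expR_gt0 (R : realType) C (s Q : 'I_C -> R) :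
  is_distribution Q -> 0 < \sum_j expR (s j).
Proof.
case: C s Q => [|C] s Q [_ Q1].
  by move: Q1; rewrite big_ord0 => /eqP; rewrite eq_sym oner_eq0.
rewrite big_ord_recl ltr_pwDl ?expR_gt0 //.
by apply: sumr_ge0 => j _; exact: expR_ge0.
Qed.

(** The identity holds term by term: factoring Z / [Q j] out of the deviation leaves
    [softmax s j - Q j]. *)
Lemma importance_weight_variance (R : realType) C (s Q : 'I_C -> R) :
  is_distribution Q -> (forall j, 0 < Q j) ->
  let Z := \sum_j expR (s j) in
  \sum_j (expR (s j) / Q j - Z) ^+ 2 * Q j = Z ^+ 2 * chi2 (softmax s) Q.
Proof.
move=> hQ Q0 Z; have Z0 : Z != 0 by rewrite gt_eqF // (sum_expR_gt0 s hQ).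
rewrite /chi2 mulr_sumr; apply: eq_bigr => j _; rewrite /softmax -/Z.
have Qj : Q j != 0 by rewrite gt_eqF.
by field; rewrite Qj Z0.
Qed.

(** * Mean and variance of the sampled softmax average *)

Section SampledSoftmax.
Context {d : measure_display} {T : measurableType d} {R : realType}.
Context (P : probability T R) {C k : nat} (s Q : 'I_C -> R).
Context (y : 'I_k -> T -> 'I_C).
Hypothesis Q_distr : is_distribution Q.
Hypothesis Q_gt0 : forall j, 0 < Q j.
Hypothesis k_gt0 : (0 < k)%N.
Hypothesis y_iid : iid_from P Q y.

Let Z : R := \sum_j expR (s j).
Let average (v : {ffun 'I_k -> 'I_C}) : R :=
  k%:R^-1 * \sum_i (expR (s (v i)) / Q (v i)).

Let kN0 : k%:R != 0 :> R. Proof. by rewrite pnatr_eq0 -lt0n. Qed.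

Lemma ssm_averageE : ssm_average s Q y = average \o sample_vector y.
Proof.
apply/funext => w; rewrite /ssm_average /average /=; congr (_ * _).
by apply: eq_bigr => i _; rewrite ffunE.
Qed.

Lemma ssm_average_Lfun2 : ssm_average s Q y \in Lfun P 2%:E.
Proof.
rewrite ssm_averageE; apply: Lfun2_fin_rv.
exact: measurable_sample_vector_fiber y_iid.
Qed.

Lemma ssm_average_mean : rv_mean P (ssm_average s Q y) = Z.
Proof.
rewrite /rv_mean ssm_averageE (expectation_sample_vector y_iid) /=.
under eq_bigr do rewrite -mulrA.
rewrite -mulr_sumr (sample_vector_sum_mean y_iid (fun j => expR (s j) / Q j)).
by rewrite importance_weight_mean // mulKf.
Qed.

Lemma ssm_average_variance :
  rv_variance P (ssm_average s Q y) = Z ^+ 2 * chi2 (softmax s) Q / k%:R.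
Proof.
rewrite /rv_variance /variance covariance.unlock -/(rv_mean P (ssm_average s Q y)).
rewrite ssm_average_mean.
(* Since k is nonzero, Z is the average of k copies of itself, so the deviation of the average from
   Z is the average of the centered weights [g]; squaring produces the factor [k%:R ^- 2]. *)
pose g j := expR (s j) / Q j - Z.
rewrite [X in expectation P X](_ : _ =
    (fun v : {ffun 'I_k -> 'I_C} => k%:R ^- 2 * (\sum_i g (v i)) ^+ 2) \o sample_vector y); last first.
  apply/funext => w; rewrite ssm_averageE !fctE /= /average /g sumrB sumr_const card_ord.
  by rewrite -(mulr_natl Z); field.
rewrite (expectation_sample_vector y_iid) /=.
under eq_bigr do rewrite -mulrA.
rewrite -mulr_sumr (sample_vector_sum_sqr y_iid) ?importance_weight_variance //.
  by rewrite -/Z; field.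
(* It remains to check that [g] is centered under [Q]: the weights have mean Z, and the constant Z
   has mean Z because [Q] has total mass 1. *)
rewrite /g; under eq_bigr do rewrite mulrBl.
by rewrite sumrB importance_weight_mean // -mulr_sumr Q_distr.2 mulr1 subrr.
Qed.

End SampledSoftmax.

Theorem mainTheorem12 (R : realType) (C k : nat) (s Q : 'I_C -> R)
    (d : measure_display) (T : measurableType d) (P : probability T R)
    (y : 'I_k -> T -> 'I_C)
    (hQ : is_distribution Q) (hQpos : forall j : 'I_C, 0 < Q j)
    (hk : (1 <= k)%N) (hy : iid_from P Q y) :
  let X := ssm_average s Q y in
  [/\ delta_method_defined P (@ln R) X,
      delta_bias_asym P (@ln R) X s = 0,
      delta_bias_curv P (@ln R) X = - (1 / (2 * k%:R)) * chi2 (softmax s) Q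
    & delta_variance P (@ln R) X = 1 / k%:R * chi2 (softmax s) Q].
Proof.
move=> X.
(* Positivity puts the mean of X at a point where [ln] is twice differentiable; nonvanishing permits
   the final cancellations. *)
have Z0 : 0 < \sum_j expR (s j) := sum_expR_gt0 s hQ.
have ZN0 : \sum_j expR (s j) != 0 by rewrite gt_eqF.
have k0 : k%:R != 0 :> R by rewrite pnatr_eq0 -lt0n.
have meanX : rv_mean P X = \sum_j expR (s j) by exact: ssm_average_mean.
have varX := ssm_average_variance s hQ hQpos hk hy.
split.
- split; first exact: ssm_average_Lfun2 hy.
  by rewrite meanX; exact: twice_derivable_ln.
- by rewrite /delta_bias_asym meanX subrr.
- rewrite /delta_bias_curv varX meanX derive1nS derive1n1 derive1E.
  have /@derive_val -> := is_derive_derive1_ln Z0.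
  by field; rewrite k0 ZN0.
- rewrite /delta_variance varX meanX derive1E.
  have /@derive_val -> := is_derive1_ln Z0.
  by field; rewrite k0 ZN0.
Qed.
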